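(* Let $p$ be a natural number with $p \geq 3$. Then $p$ is prime if and only if $$(p-3)! \equiv \frac{p-1}{2} \pmod{p}.$$
   Context: Here $\frac{p-1}{2}$ is the exact rational quotient (not a rounded integer division), and $x \equiv y \pmod p$ means that $x-y$ is an integer multiple of $p$; in particular the congruence does not hold when $\frac{p-1}{2}$ is not an integer. *)

(* Defs.v *)
From mathcomp Require Import all_boot all_order all_algebra.
Set Implicit Arguments.
Unset Strict Implicit.
Unset Printing Implicit Defensive.
Import GRing.Theory.
Local Open Scope ring_scope.

(* The multiplier k is an integer, so x and y are congruent only if their
   difference is itself an integer. *)
Definition eqmod_rat (m : nat) (x y : rat) : Prop :=
  exists k : int, x - y = k%:~R * m%:R.

(* Main.v *)
Require Import Defs.
From mathcomp Require Import all_boot all_order all_algebra.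
From mathcomp Require Import ring zify.
Import GRing.Theory.
Local Open Scope ring_scope.

(** Since [(p-1)(p-2) = 2 + p(p-3)], Wilson's criterion [p %| (p-1)! + 1] is
    equivalent to [p %| 2(p-3)! + 1].  Doubling the rational congruence
    [(p-3)! - (p-1)/2 = k p] gives [2(p-3)! + 1 = (2k+1) p]; conversely, every
    quotient of the odd number [2(p-3)! + 1] is odd, hence of the form [2k+1]. *)

Lemma Wilson_fact_sub3 (n : nat) : prime n.+3 = (n.+3 %| (n`!).*2.+1)%N.
Proof.
(* Adding this multiple of [n.+3] turns [2 n! + 1] into [(n+2)! + 1], as
   [(n+2)(n+1) = n(n+3) + 2]. *)
rewrite Wilson //= -[RHS](@dvdn_addr (n.+3 * (n * n`!))) ?dvdn_mulr //.
congr (_ %| _)%N; rewrite !factS; nia.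
Qed.

(** For even [m] both sides fail: [(m-1)/2] is not an integer, and [m] cannot divide an odd
    number. *)
Lemma eqmod_rat_halfP (m n : nat) :
  eqmod_rat m n%:R ((m%:R - 1) / 2%:R) <-> (m %| n.*2.+1)%N.
Proof.
split=> [[k Hk]|/dvdnP[q Hq]].
- have E : (n.*2.+1)%:Z = (k * 2 + 1) * m%:Z.
    apply: (@intr_inj rat).
    rewrite rmorphM rmorphD rmorphM /= -!pmulrn -addn1 -muln2 natrD natrM.
    have -> : n%:R = k%:~R * m%:R + (m%:R - 1) / 2%:R :> rat.
      by rewrite -Hk subrK.
    by field.
  have : (m%:Z %| (n.*2.+1)%:Z)%Z by rewrite E dvdz_mull.
  (* On these operands [%|] over [int] computes to [%|] over [nat]. *)
  by [].
- have oddq : odd q.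
    by move/(congr1 odd): Hq; rewrite oddM /= odd_double => /esym/andP[].
  exists (q./2)%:Z; rewrite -pmulrn.
  have Eq : q = (q./2 * 2 + 1)%N by rewrite -{1}(odd_double_half q) oddq; lia.
  move: Hq => /(congr1 (fun i : nat => i%:R : rat)).
  rewrite {1}Eq -addn1 -muln2 natrD !natrM natrD natrM => Hq.
  have -> : n%:R = (((q./2)%:R * 2%:R + 1) * m%:R - 1) / 2%:R :> rat.
    by rewrite -Hq; field.
  by field.
Qed.

Theorem theorem1 (p : nat) (hp : (3 <= p)%N) :
  prime p <-> eqmod_rat p ((p - 3)`!)%N%:R ((p%:R - 1) / 2%:R).
Proof.
(* With [p = n.+3] the truncated [p - 3] is exactly [n]. *)
case: p hp => [|[|[|n]]] // _.
by rewrite eqmod_rat_halfP Wilson_fact_sub3 !subSS subn0.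
Qed.
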